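(* Let $(W,S)$ be a Coxeter system with $S$ finite. Let $x\in W$ and $\beta\in\Phi(x)$ be such that there exists $y\in W$ with $\Phi(x)\cap\Phi(y)=\{\beta\}$. Then there exists a unique minimal length element $y_\beta\in W$ such that $$\Phi(x)\cap\Phi(y_\beta)=\{\beta\}.$$ Furthermore, $y_\beta\in\Gamma^0$, and the set $\partial T(x^{-1})_\beta=\{y\in W\mid \Phi(x)\cap\Phi(y)=\{\beta\}\}$ is a convex, gated subset of $W$.
   Context: $(W,S)$ is a Coxeter system with $S$ finite and $\ell$ is the word length with respect to $S$. $V$ is the real vector space with basis $\{\alpha_s\mid s\in S\}$ and symmetric bilinear form $\langle\alpha_s,\alpha_t\rangle=-\cos(\pi/m(s,t))$ (equal to $-1$ if $m(s,t)=\infty$); $W$ acts on $V$ by $sv=v-2\langle v,\alpha_s\rangle\alpha_s$. The root system is $\Phi=\{w\alpha_s\mid w\in W,s\in S\}=\Phi^+\sqcup\Phi^-$ (positive and negative roots). The (left) inversion set of $w\in W$ is $\Phi(w)=\{\alpha\in\Phi^+\mid w^{-1}\alpha\in\Phi^-\}$. Right weak order: $x\preceq y$ iff $\ell(y)=\ell(x)+\ell(x^{-1}y)$. Right descent set: $D_R(w)=\{s\in S\mid\ell(ws)=\ell(w)-1\}$; right-descent roots: $\Phi^R(w)=\{-w\alpha_s\mid s\in D_R(w)\}$. Cone type of $w$: $T(w)=\{v\in W\mid\ell(wv)=\ell(w)+\ell(v)\}$; $\mathbb{T}=\{T(w)\mid w\in W\}$. For $T\in\mathbb{T}$ the cone type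 part is $Q(T)=\{x\in W\mid T(x^{-1})=T\}$. It is known that each $Q(T)$ has a unique element $g_T\in Q(T)$ with $g_T\preceq x$ for all $x\in Q(T)$, called the gate of $Q(T)$. The set of gates is $\Gamma=\{g_T\mid T\in\mathbb{T}\}$, and the set of tight gates is $\Gamma^0=\{g\in\Gamma\mid|\Phi^R(g)|=1\}$. A subset $X\subseteq W$ is gated if there is a (unique, minimal length) element $x\in X$ such that $x\preceq y$ for all $y\in X$. It is convex if for all $x,y\in X$ and all reduced expressions $x^{-1}y=s_1\cdots s_n$, the elements $xs_1\cdots s_j$, $0\le j\le n$, lie in $X$. *)

(* Defs.v *)
From HB Require Import structures.
From mathcomp Require Import all_boot all_order all_algebra.
From mathcomp Require Import all_classical all_reals all_analysis.

Set Implicit Arguments.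
Unset Strict Implicit.
Unset Printing Implicit Defensive.

Import Order.TTheory GRing.Theory Num.Theory.

Local Open Scope classical_set_scope.

(* A Coxeter matrix over S; the value None encodes m(s,t) = infinity. *)
Record coxeter_matrix (S : finType) := CoxeterMatrix {
  cox_entry :> S -> S -> option nat;
  cox_entry_diag : forall s, cox_entry s s = Some 1%N;
  cox_entry_sym : forall s t, cox_entry s t = cox_entry t s;
  cox_entry_ge2 : forall s t k, s != t -> cox_entry s t = Some k -> (2 <= k)%N
}.

Definition satisfies_coxeter_relations (S : finType) (m : coxeter_matrix S)
    (G : groupType) (f : S -> G) : Prop :=
  forall s t k, m s t = Some k -> ((f s * f t) ^+ k = 1)%g.

Definition word_prod (S : Type) (G : groupType) (f : S -> G) (u : seq S) : G :=
  (\prod_(s <- u) f s)%g.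

(* W has the presentation < S | (s t)^m(s,t) = 1 whenever m(s,t) is finite >.
   The relations m(s,s) = 1 make the generators involutions, so products of
   generators without inverses already exhaust the subgroup they generate.
   The homomorphism in cox_universal is unique because of cox_generated. *)
Record coxeter_system (W : groupType) (S : finType) := CoxeterSystem {
  cox_matrix : coxeter_matrix S;
  cox_gen : S -> W;
  cox_relations : satisfies_coxeter_relations cox_matrix cox_gen;
  cox_generated : forall w, exists u : seq S, word_prod cox_gen u = w;
  cox_universal : forall (G : groupType) (f : S -> G),
    satisfies_coxeter_relations cox_matrix f ->
    exists h : {multiplicative W -> G}, forall s, h (cox_gen s) = f s
}.

Section Length.
Variables (W : groupType) (S : finType) (C : coxeter_system W S).

Let expressible (w : W) (n : nat) : Prop :=
  exists2 u : seq S, size u = n & word_prod (cox_gen C) u = w.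

Lemma expressible_ex (w : W) : exists n, `[< expressible w n >].
Proof.
by have [u uw] := cox_generated C w; exists (size u); apply/asboolP; exists u.
Qed.

Definition cox_length (w : W) : nat := ex_minn (expressible_ex w).

Definition reduced_expression (w : W) (u : seq S) : Prop :=
  word_prod (cox_gen C) u = w /\ size u = cox_length w.

Definition right_weak_le (x y : W) : Prop :=
  cox_length y = (cox_length x + cox_length (x^-1 * y)%g)%N.

Definition right_descent (w : W) : set S :=
  [set s | (cox_length (w * cox_gen C s)%g).+1 = cox_length w].

Definition cone_type (w : W) : set W :=
  [set v | cox_length (w * v)%g = (cox_length w + cox_length v)%N].

Definition cone_types : set (set W) := range cone_type.

Definition cone_type_part (T : set W) : set W :=
  [set x | cone_type (x^-1)%g = T].

Definition is_gate (T : set W) (g : W) : Prop :=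
  cone_type_part T g /\ forall x, cone_type_part T x -> right_weak_le g x.

Definition gates : set W := [set g | exists2 T, cone_types T & is_gate T g].

(* Being of minimal length in X is a consequence of x being below every
   element of X. *)
Definition gated (X : set W) : Prop :=
  exists! x, X x /\ forall y, X y -> right_weak_le x y.

Definition convex_subset (X : set W) : Prop :=
  forall x y, X x -> X y ->
  forall u, reduced_expression (x^-1 * y)%g u ->
  forall j, (j <= size u)%N -> X (x * word_prod (cox_gen C) (take j u))%g.

End Length.

Section Roots.
Variables (R : realType) (W : groupType) (S : finType).
Variable C : coxeter_system W S.

Local Open Scope ring_scope.

(* The space with basis (alpha_s), a vector being the family of its
   coordinates. *)
Notation V := {ffun S -> R^o}.

Definition simple_root (s : S) : V := [ffun t => (t == s)%:R].

Definition cox_gram (s t : S) : R :=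
  if cox_matrix C s t is Some k then - cos (pi / k%:R) else -1.

Definition cox_form (u v : V) : R :=
  \sum_(s : S) \sum_(t : S) u s * v t * cox_gram s t.

Definition simple_reflection (s : S) (v : V) : V :=
  v - (2 * cox_form v (simple_root s)) *: simple_root s.

(* The action of w composes the simple reflections along a chosen word for w;
   the result does not depend on that choice, since the simple reflections
   satisfy the Coxeter relations. *)
Definition cox_act (w : W) (v : V) : V :=
  foldr simple_reflection v (sval (cid (cox_generated C w))).

Definition cox_roots : set V :=
  [set a | exists w s, a = cox_act w (simple_root s)].

Definition positive_roots : set V :=
  [set a | cox_roots a /\ forall s, 0 <= a s].

Definition negative_roots : set V :=
  [set a | cox_roots a /\ forall s, a s <= 0].

Definition inversions (w : W) : set V :=
  [set a | positive_roots a /\ negative_roots (cox_act (w^-1)%g a)].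

Definition right_descent_roots (w : W) : set V :=
  [set - cox_act w (simple_root s) | s in right_descent C w].

Definition tight_gates : set W :=
  [set g | gates C g /\ (right_descent_roots g #= `I_1)%card].

Definition cone_boundary (x : W) (b : V) : set W :=
  [set y | inversions x `&` inversions y = [set b]].

End Roots.

(* Main.v *)
(* Write Phi(w) for the inversion set and X = { y | Phi(x) /\ Phi(y) = {beta} }.
   X is cut out by half-spaces, hence convex.  To see that X is gated, descend
   inside X by steps y -> y s that shorten y.  If y s and y t both lie in X, then
   so does the minimal representative y0 of the coset y W_{s,t}: otherwise beta
   is a nonnegative combination of -y alpha_s and -y alpha_t, and since x^-1 beta
   is negative one of these two roots lies in Phi(x) /\ Phi(y) = {beta}, which
   contradicts y s, y t in X.  By Newman's lemma the descents from a given y end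
   at a single element, and by convexity it is the same for all y in X.
   This gate g has beta as its only descent root.  Let h = w s be the gate of
   { h | Phi(g) /\ Phi(h) = {beta} }.  Then w lies in the cone of g^-1 and h does
   not, so every z with T(z^-1) = T(g^-1) satisfies Phi(h) /\ Phi(z) = {beta};
   since g is also the gate of { y | Phi(h) /\ Phi(y) = {beta} }, it lies below z. *)
From HB Require Import structures.
Require Import Defs.
From mathcomp Require Import all_boot all_order all_algebra.
From mathcomp Require Import all_classical all_reals all_analysis.
From mathcomp Require Import zify ring.

Set Implicit Arguments.
Unset Strict Implicit.
Unset Printing Implicit Defensive.

Import Order.TTheory GRing.Theory Num.Theory.

(** * Words and lengths *)

(** Groups of bijections are the targets of the universal property: on [bool] they give the sign
    character, on the root space the geometric action. The inverse is stored as data so that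
    inversion in the group needs no choice; equality depends on the forward map only. *)
Record bijection (T : Type) := Bijection {
  bij_fun :> T -> T;
  bij_inv : T -> T;
  bij_funK : cancel bij_fun bij_inv;
  bij_invK : cancel bij_inv bij_fun
}.

HB.instance Definition _ (T : Type) := gen_eqMixin (bijection T).
HB.instance Definition _ (T : Type) := gen_choiceMixin (bijection T).

Section BijectionGroup.
Variable T : Type.
Implicit Types f g h : bijection T.

Lemma bijectionP f g : bij_fun f =1 bij_fun g -> f = g.
Proof.
case: f g => f f' fK f'K [g g' gK g'K] /= /funext fg.
move: fK f'K; rewrite {}fg => fK f'K.
have f'g' : f' = g' by apply/funext => y; rewrite -{1}(g'K y) fK.
by subst f'; congr Bijection; exact: Prop_irrelevance.
Qed.

Definition bij_one := @Bijection T id id (fun=> erefl) (fun=> erefl).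
Definition bij_mul f g := Bijection (can_comp (bij_funK f) (bij_funK g))
  (can_comp (bij_invK g) (bij_invK f)).
Definition bij_V f := Bijection (bij_invK f) (bij_funK f).

Lemma bij_mulA : associative bij_mul. Proof. by move=> f g h; exact: bijectionP. Qed.
Lemma bij_mul1 : left_id bij_one bij_mul. Proof. by move=> f; exact: bijectionP. Qed.
Lemma bij_mulr1 : right_id bij_one bij_mul. Proof. by move=> f; exact: bijectionP. Qed.
Lemma bij_mulV : left_inverse bij_one bij_V bij_mul.
Proof. by move=> f; apply: bijectionP => x; exact: bij_funK. Qed.
Lemma bij_mulrV : right_inverse bij_one bij_V bij_mul.
Proof. by move=> f; apply: bijectionP => x; exact: bij_invK. Qed.

HB.instance Definition _ := isGroup.Build (bijection T)
  bij_mulA bij_mul1 bij_mulr1 bij_mulV bij_mulrV.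

Lemma bij_fun_prod (I : Type) (F : I -> bijection T) (u : seq I) (v : T) :
  bij_fun (word_prod F u) v = foldr F v u.
Proof.
by rewrite /word_prod; elim: u => [|i u IH]; rewrite ?big_nil // big_cons /= IH.
Qed.

End BijectionGroup.

(** * The length function *)

Section LengthTheory.
Variables (W : groupType) (S : finType) (C : coxeter_system W S).
Local Open Scope group_scope.

Local Notation sg := (cox_gen C).
Local Notation len := (cox_length C).
Local Notation wp := (word_prod (cox_gen C)).

Lemma wp_nil : wp [::] = 1. Proof. exact: big_nil. Qed.
Lemma wp_cons s u : wp (s :: u) = sg s * wp u. Proof. exact: big_cons. Qed.
Lemma wp_cat u v : wp (u ++ v) = wp u * wp v. Proof. exact: big_cat. Qed.
Lemma wp_rcons u s : wp (rcons u s) = wp u * sg s.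
Proof. by rewrite -cats1 wp_cat wp_cons wp_nil mulg1. Qed.

Lemma cox_gen_sq s : sg s * sg s = 1.
Proof. exact: (cox_relations (cox_entry_diag (cox_matrix C) s)). Qed.
Lemma cox_genV s : (sg s)^-1 = sg s.
Proof. by apply: (mulgI (sg s)); rewrite mulgV cox_gen_sq. Qed.
Lemma mulg_genK s w : w * sg s * sg s = w.
Proof. by rewrite -mulgA cox_gen_sq mulg1. Qed.

Lemma wp_rev u : wp (rev u) = (wp u)^-1.
Proof.
elim: u => [|s u IH]; first by rewrite wp_nil invg1.
by rewrite rev_cons wp_rcons wp_cons IH invgM cox_genV.
Qed.

Lemma cox_length_wp u : (len (wp u) <= size u)%N.
Proof.
rewrite /cox_length; case: ex_minnP => n _; apply; apply/asboolP.
by exists u.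
Qed.

Lemma reduced_ex w : exists u, reduced_expression C w u.
Proof.
rewrite /reduced_expression /cox_length; case: ex_minnP => n /asboolP[u <- <-] _.
by exists u.
Qed.

Lemma cox_length1 : len 1 = 0%N.
Proof. by apply/eqP; rewrite -leqn0 -wp_nil (cox_length_wp [::]). Qed.

Lemma cox_length_eq0 w : len w = 0%N -> w = 1.
Proof.
have [u [<- eu]] := reduced_ex w; rewrite -eu => /size0nil ->.
by rewrite wp_nil.
Qed.

Lemma cox_lengthM v w : (len (v * w) <= len v + len w)%N.
Proof.
have [u [<- <-]] := reduced_ex v; have [u' [<- <-]] := reduced_ex w.
by rewrite -wp_cat -size_cat cox_length_wp.
Qed.

Lemma cox_lengthV w : len w^-1 = len w.
Proof.
have le v : (len v^-1 <= len v)%N.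
  by have [u [<- <-]] := reduced_ex v; rewrite -wp_rev -size_rev cox_length_wp.
by apply/eqP; rewrite eqn_leq le -{1}[w]invgK le.
Qed.

(** This is the sign character. Sending every generator to negation respects all relations, because
    a product of two generators already goes to the identity. *)
Lemma cox_parity : exists p : W -> bool, forall u, p (wp u) = odd (size u).
Proof.
pose flip := Bijection negbK negbK.
have flip2 : flip * flip = 1 by apply: bijectionP => b; exact: negbK.
have [h hE] : exists h : {multiplicative W -> bijection bool},
    forall s, h (sg s) = flip.
  apply: cox_universal => s t k _.
  by rewrite flip2 expg1n.
have h1 : h 1 = 1.
  by apply: (mulgI (h 1)); rewrite -gmulfM !mulg1.
exists (fun w => bij_fun (h w) false) => u; elim: u => [|s u IH].
  by rewrite wp_nil h1.
by rewrite wp_cons gmulfM hE /= -IH.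
Qed.

(** Subadditivity bounds the change of length by one, and parity excludes no change. *)
Lemma cox_length_gen w s :
  len (w * sg s) = (len w).+1 \/ (len (w * sg s)).+1 = len w.
Proof.
have up v : (len (v * sg s) <= (len v).+1)%N.
  have [u [<- <-]] := reduced_ex v.
  by rewrite -wp_rcons -(size_rcons u s) cox_length_wp.
have := up (w * sg s); rewrite mulg_genK.
have := up w.
have [p pE] := cox_parity.
have [u [eu su]] := reduced_ex w.
have [u' [eu' su']] := reduced_ex (w * sg s).
have : odd (len (w * sg s)) != odd (len w).
  rewrite -su -su' -!pE eu' eu -eu -wp_rcons !pE size_rcons /=.
  by case: (odd _).
lia.
Qed.

Lemma descent_ex w : w <> 1 -> exists s, (len (w * sg s)).+1 = len w.
Proof.
have [u [eu su]] := reduced_ex w.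
case/lastP: u eu su => [|u s] eu su w1; first by case: w1; rewrite -eu wp_nil.
exists s; case: (cox_length_gen w s) => // lw.
have : (len (w * sg s) <= size u)%N.
  by rewrite -eu wp_rcons mulg_genK cox_length_wp.
by move: su; rewrite lw size_rcons; lia.
Qed.

(** A shorter prefix, completed by the remaining letters of [u], would make the whole product too
    short. *)
Lemma cox_length_prefix v u (n : nat) :
  len (v * wp u) = (len v + size u)%N -> (n <= size u)%N ->
  len (v * wp (take n u)) = (len v + n)%N.
Proof.
move=> lu nu.
have := cox_lengthM v (wp (take n u)).
have := cox_length_wp (take n u).
have := cox_lengthM (v * wp (take n u)) (wp (drop n u)).
have := cox_length_wp (drop n u).
rewrite -mulgA -wp_cat cat_take_drop lu size_drop size_take_min; lia.
Qed.

(** * Words in two generators *)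

(** The word is built from the right, with last letter [t], because descents are read on the right
    and [foldr] applies the last letter first. *)
Fixpoint alt_word (s t : S) (n : nat) : seq S :=
  if n is n'.+1 then rcons (alt_word t s n') t else [::].

Lemma size_alternating s t n : size (alt_word s t n) = n.
Proof. by elim: n s t => //= n IH s t; rewrite size_rcons IH. Qed.

Lemma alternating_suffix s t n k :
  exists2 u, size u = n & alt_word s t (n + k) = u ++ alt_word s t k.
Proof.
elim: k s t => [|k IH] s t.
  by exists (alt_word s t n); rewrite ?size_alternating// addn0 cats0.
have [u su eu] := IH t s; exists u => //.
by rewrite addnS /= eu rcons_cat.
Qed.

(* All prefixes of [u] inherit the length equation, so no letter is repeated. *)
Lemma reduced_alternating s t v u : all [in [:: s; t]] u ->
  len (v * wp u) = (len v + size u)%N ->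
  u = alt_word s t (size u) \/ u = alt_word t s (size u).
Proof.
elim/last_ind: u => [|u z IH]; first by left.
rewrite all_rcons size_rcons => /andP[zst uall] lu.
have lu' : len (v * wp u) = (len v + size u)%N.
  have := @cox_length_prefix v (rcons u z) (size u).
  by rewrite size_rcons -[in take _ _]cats1 take_size_cat //; apply.
have no_repeat u' : u <> rcons u' z.
  move=> eu; have : (len (v * wp (rcons u z)) <= len v + size u')%N.
    rewrite eu 2!wp_rcons mulg_genK (leq_trans (cox_lengthM _ _))//.
    by rewrite leq_add2l cox_length_wp.
  by rewrite lu eu size_rcons; lia.
case: (IH uall lu') => eu; move: zst; rewrite !inE => /orP[] /eqP ez; subst z.
- by right; rewrite /= -eu.
- case su : (size u) => [|n]; first by left; rewrite (size0nil su).
  by case: (no_repeat (alt_word t s n)); rewrite eu su.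
- case su : (size u) => [|n]; first by right; rewrite (size0nil su).
  by case: (no_repeat (alt_word s t n)); rewrite eu su.
- by left; rewrite /= -eu.
Qed.

Lemma wp_alternating_quotient s t n :
  (wp (alt_word t s n))^-1 * wp (alt_word s t n) = (sg s * sg t) ^+ n.
Proof.
elim: n s t => [|n IH] s t; first by rewrite !wp_nil invg1 mulg1.
have comm : sg s * (sg t * sg s) ^+ n = (sg s * sg t) ^+ n * sg s.
  elim: n {IH} => [|n IH]; first by rewrite mulg1 mul1g.
  by rewrite expgSr mulgA IH [in RHS]expgSr !mulgA.
by rewrite /= !wp_rcons invgM cox_genV -mulgA (mulgA _ _ (sg t)) IH mulgA comm
  -mulgA expgSr.
Qed.

Lemma wp_alternating_sym s t k : cox_matrix C s t = Some k ->
  wp (alt_word s t k) = wp (alt_word t s k).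
Proof.
move=> mst; have := wp_alternating_quotient s t k.
by rewrite (cox_relations mst) => /mulg1_eq; rewrite invgK.
Qed.

(** Descents [s] and [t] are stripped from the right until none is left; [v] is then the minimal
    representative of the coset of [w] modulo the subgroup generated by s and t. *)
Lemma coset_decomposition s t w : exists v u,
  [/\ w = v * wp u, all [in [:: s; t]] u, len w = (len v + size u)%N,
      len (v * sg s) = (len v).+1 & len (v * sg t) = (len v).+1].
Proof.
elim/ltn_ind: {w}(len w) {-2}w (erefl (len w)) => n IH w lw.
have step z : z \in [:: s; t] -> (len (w * sg z)).+1 = len w -> exists v u,
  [/\ w = v * wp u, all [in [:: s; t]] u, len w = (len v + size u)%N,
      len (v * sg s) = (len v).+1 & len (v * sg t) = (len v).+1].
  move=> zst lz.
  have [|v [u [eu uall lu ls lt]]] := IH (len (w * sg z)) _ _ erefl.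
    by rewrite -lw -lz.
  exists v, (rcons u z); split=> //.
  - by rewrite wp_rcons mulgA -eu mulg_genK.
  - by rewrite all_rcons uall andbT.
  - by rewrite -lz lu size_rcons addnS.
case: (cox_length_gen w s) => ls; last by apply: (step s); rewrite ?inE ?eqxx.
case: (cox_length_gen w t) => lt; last by apply: (step t); rewrite ?inE ?eqxx ?orbT.
exists w, [::]; split=> //; first by rewrite wp_nil mulg1.
by rewrite addn0.
Qed.

(* When n >= k, the last k letters may be replaced by a word ending in s. *)
Lemma alternating_lt s t k n v w : cox_matrix C s t = Some k -> (0 < k)%N ->
  w = v * wp (alt_word s t n) -> len w = (len v + n)%N ->
  len (w * sg s) = (len w).+1 -> (n < k)%N.
Proof.
move=> mst k0 ew lw ls; rewrite ltnNge; apply/negP => kn.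
have [u su eu] := alternating_suffix s t (n - k) k.
rewrite subnK// in eu.
have : (len (w * sg s) <= len v + (n - k) + k.-1)%N.
  rewrite ew eu wp_cat (wp_alternating_sym mst).
  case: k k0 {mst kn eu} su => // k _ su /=.
  rewrite wp_rcons !mulgA mulg_genK -mulgA -wp_cat.
  rewrite (leq_trans (cox_lengthM _ _))// -addnA leq_add2l.
  by rewrite (leq_trans (cox_length_wp _))// size_cat su size_alternating.
rewrite ls lw; lia.
Qed.

End LengthTheory.

(** * The geometric representation *)

Section Chebyshev.
Variable R : realType.
Local Open Scope ring_scope.

(* With [c = cos th], [chebyshev c n] is [sin (n th) / sin th]. *)
Fixpoint chebyshev2 (c : R) (n : nat) : R * R :=
  if n is n'.+1 then
    let p := chebyshev2 c n' in (p.2, 2 * c * p.2 - p.1)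
  else (0, 1).
Definition chebyshev (c : R) (n : nat) : R := (chebyshev2 c n).1.

Lemma chebyshev0 c : chebyshev c 0 = 0. Proof. by []. Qed.
Lemma chebyshev1 c : chebyshev c 1 = 1. Proof. by []. Qed.
Lemma chebyshevSS c n :
  chebyshev c n.+2 = 2 * c * chebyshev c n.+1 - chebyshev c n.
Proof. by []. Qed.

(** The value c = 1 belongs to m(s,t) = infinity. *)
Lemma chebyshev_one n : chebyshev 1 n = n%:R.
Proof.
suff [] : chebyshev 1 n = n%:R /\ chebyshev 1 n.+1 = n.+1%:R by [].
elim: n => [//|n [IH1 IH2]]; split=> //.
by rewrite chebyshevSS IH1 IH2 -!natr1; ring.
Qed.

Lemma chebyshev_cos (th : R) n : sin th * chebyshev (cos th) n = sin (th *+ n).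
Proof.
suff [] : sin th * chebyshev (cos th) n = sin (th *+ n) /\
  sin th * chebyshev (cos th) n.+1 = sin (th *+ n.+1) by [].
elim: n => [|n [IH1 IH2]].
  by rewrite chebyshev0 chebyshev1 mulr0 mulr1 mulr0n sin0 mulr1n.
split=> //; rewrite chebyshevSS mulrBr IH1 mulrCA IH2.
have -> : th *+ n = th *+ n.+1 - th by rewrite mulrSr addrK.
by rewrite sinB [th *+ n.+2]mulrSr sinD; ring.
Qed.

End Chebyshev.

(** * The bilinear form and the simple reflections *)

Section Geometry.
Variables (R : realType) (W : groupType) (S : finType).
Variable C : coxeter_system W S.
Local Open Scope ring_scope.

Local Notation V := {ffun S -> R^o}.
Local Notation root0 := (@simple_root R S).
Local Notation form := (@cox_form R W S C).
Local Notation refl := (@simple_reflection R W S C).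
Local Notation gram := (@cox_gram R W S C).
Local Notation sg := (cox_gen C).
Local Notation wp := (word_prod (cox_gen C)).
Local Notation act := (@cox_act R W S C).
Implicit Types (u v w : V) (a : R).

Lemma cox_gram_sym s t : gram s t = gram t s.
Proof. by rewrite /cox_gram cox_entry_sym. Qed.

Lemma cox_gram_diag s : gram s s = 1.
Proof. by rewrite /cox_gram cox_entry_diag divr1 cospi opprK. Qed.

Lemma cox_form_linear a u v w : form (a *: u + v) w = a * form u w + form v w.
Proof.
rewrite /cox_form mulr_sumr -big_split; apply: eq_bigr => s _ /=.
rewrite mulr_sumr -big_split; apply: eq_bigr => t _ /=.
rewrite !ffunE /= /GRing.scale /=; ring.
Qed.

Lemma cox_form_sym u v : form u v = form v u.
Proof.
rewrite /cox_form exchange_big; apply: eq_bigr => s _ /=.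
by apply: eq_bigr => t _ /=; rewrite cox_gram_sym (mulrC (u t)).
Qed.

Lemma cox_formE v s : form v (root0 s) = \sum_t v t * gram t s.
Proof.
apply: eq_bigr => t _; rewrite (bigD1 s)//= ffunE eqxx mulr1 big1 ?addr0//.
by move=> t' /negbTE nt; rewrite ffunE nt mulr0 mul0r.
Qed.

Lemma cox_form_simple s t : form (root0 s) (root0 t) = gram s t.
Proof.
rewrite cox_formE (bigD1 s)//= ffunE eqxx mul1r big1 ?addr0// => t' /negbTE nt.
by rewrite ffunE nt mul0r.
Qed.

Lemma cox_formD u v w : form (u + v) w = form u w + form v w.
Proof. by rewrite -[u]scale1r cox_form_linear mul1r scale1r. Qed.

Lemma cox_form0 w : form 0 w = 0.
Proof. by apply: (addrI (form 0 w)); rewrite -cox_formD !addr0. Qed.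

Lemma cox_formZ a u w : form (a *: u) w = a * form u w.
Proof. by rewrite -[_ *: _]addr0 cox_form_linear cox_form0 addr0. Qed.

Lemma cox_formB u v w : form (u - v) w = form u w - form v w.
Proof. by rewrite -scaleN1r addrC cox_form_linear mulN1r addrC. Qed.

Lemma reflE s v t : refl s v t = v t - 2 * form v (root0 s) * (t == s)%:R.
Proof. by rewrite !ffunE. Qed.

Lemma refl_linear s a u v : refl s (a *: u + v) = a *: refl s u + refl s v.
Proof.
apply/ffunP => t; rewrite reflE cox_form_linear !ffunE /= /GRing.scale /=.
by ring.
Qed.

Lemma refl_simple s t :
  refl t (root0 s) = root0 s + (2 * - gram s t) *: root0 t.
Proof. by rewrite /simple_reflection cox_form_simple mulrN scaleNr. Qed.

Lemma refl_self s : refl s (root0 s) = - root0 s.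
Proof.
rewrite refl_simple cox_gram_diag; apply/ffunP => t.
by rewrite !ffunE /= /GRing.scale /=; ring.
Qed.

Lemma cox_form_refl s u v : form (refl s u) (refl s v) = form u v.
Proof.
rewrite /simple_reflection cox_formB cox_formZ.
rewrite 2!(cox_form_sym _ (v - _)) !cox_formB !cox_formZ cox_form_simple.
rewrite cox_gram_diag (cox_form_sym u) (cox_form_sym v (root0 s)).
by rewrite (cox_form_sym u); ring.
Qed.

Lemma reflK s : involutive (refl s).
Proof.
move=> v; apply/ffunP => t; rewrite reflE reflE.
have -> : form (refl s v) (root0 s) = - form v (root0 s).
  rewrite /simple_reflection cox_formB cox_formZ cox_form_simple cox_gram_diag.
  by ring.
ring.
Qed.

Lemma foldr_refl_linear (x : seq S) a u v : foldr refl (a *: u + v) x =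
  a *: foldr refl u x + foldr refl v x.
Proof. by elim: x => //= s x ->; rewrite refl_linear. Qed.

Lemma foldr_refl0 x : foldr refl 0 x = 0.
Proof.
apply: (addIr (foldr refl 0 x)).
by have := foldr_refl_linear x 1 0 0; rewrite !scale1r !addr0 add0r.
Qed.

Lemma foldr_reflN x v : foldr refl (- v) x = - foldr refl v x.
Proof.
by rewrite -[- v]addr0 -[- v]scaleN1r foldr_refl_linear foldr_refl0 addr0 scaleN1r.
Qed.

(** The coordinates in the plane of alpha_s and alpha_t follow the three-term recurrence of
    [chebyshev], with the factor 2c coming from [refl_simple]; hence the induction carries two
    consecutive lengths, for all pairs of generators. *)
Lemma foldr_refl_alternating s t k :
  let c := - gram s t in
  foldr refl (root0 s) (alt_word s t k) =
    chebyshev c k.+1 *: root0 (if odd k then t else s) +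
    chebyshev c k *: root0 (if odd k then s else t).
Proof.
move=> c; rewrite {}/c.
pose P k := forall s t, foldr refl (root0 s) (alt_word s t k) =
    chebyshev (- gram s t) k.+1 *: root0 (if odd k then t else s) +
    chebyshev (- gram s t) k *: root0 (if odd k then s else t).
suff : P k /\ P k.+1 by case=> + _; exact.
elim: k {s t} => [|k [IH1 IH2]]; split=> // s t.
- by rewrite /= chebyshev0 chebyshev1 scale0r scale1r addr0.
- by rewrite /= refl_simple chebyshevSS chebyshev0 chebyshev1 mulr1 subr0 scale1r addrC.
rewrite [alt_word _ _ _]/= foldr_rcons refl_simple (addrC (root0 s)) foldr_refl_linear.
rewrite (IH2 t s) /= foldr_rcons refl_self foldr_reflN IH1 (cox_gram_sym t s).
rewrite !chebyshevSS; apply/ffunP => z; case: (odd k) => /=;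
  rewrite !ffunE /= /GRing.scale /=; ring.
Qed.

(** For finite m the value is sin(k pi/m) / sin(pi/m) with k pi/m at most pi; for infinite m it is
    k. *)
Lemma chebyshev_ge0 s t k : s != t ->
  (if cox_matrix C s t is Some m then (k <= m)%N else true) ->
  0 <= chebyshev (- gram s t) k.
Proof.
move=> st; rewrite /cox_gram; case mst : (cox_matrix C s t) => [m|]; last first.
  by rewrite opprK chebyshev_one.
move=> km; rewrite opprK.
have m2 := cox_entry_ge2 st mst.
have m0 : (0 : R) < m%:R by rewrite ltr0n; lia.
have p0 := pi_gt0 R.
have s0 : 0 < sin (pi / m%:R : R).
  apply: sin_gt0_pi; rewrite divr_gt0//= ltr_pdivrMr// -[ltLHS]mulr1.
  by rewrite ltr_pM2l// (ltr_nat R 1 m).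
rewrite -(pmulr_rge0 _ s0) chebyshev_cos; apply: sin_ge0_pi.
rewrite mulrn_wge0 ?divr_ge0 ?(ltW p0) ?(ltW m0)//= -[_ *+ k]mulr_natr -mulrA.
rewrite ler_piMr ?(ltW p0)//.
by rewrite mulrC ler_pdivrMr// mul1r ler_nat.
Qed.

(** * The Coxeter relations for the reflections, and the action of W *)

Lemma iter_refl s t n v :
  iter n (refl s \o refl t) v = foldr refl v (alt_word s t n.*2).
Proof.
elim: n v => [//|n IH] v.
by rewrite iterSr IH doubleS /= !foldr_rcons.
Qed.

Lemma foldr_refl_fixed (s t : S) n v :
  form v (root0 s) = 0 -> form v (root0 t) = 0 ->
  iter n (refl s \o refl t) v = v.
Proof.
move=> vs vt; have fix_ z : form v (root0 z) = 0 -> refl z v = v.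
  by move=> vz; rewrite /simple_reflection vz mulr0 scale0r subr0.
by elim: n => //= n ->; rewrite fix_ // fix_.
Qed.

(** With th = pi/k the angle 2k th is a full turn, so the sines at 2k and its neighbours are 0 and
    plus or minus sin th. The first quantity is the Gram determinant of the plane of alpha_s and
    alpha_t. *)
Lemma chebyshev_period s t k : s != t -> cox_matrix C s t = Some k ->
  [/\ 1 - gram s t ^+ 2 != 0, chebyshev (- gram s t) k.*2 = 0,
      chebyshev (- gram s t) k.*2.+1 = 1 &
      chebyshev (- gram s t) k.*2.-1 = - 1].
Proof.
move=> st mst; rewrite /cox_gram mst opprK.
have m2 := cox_entry_ge2 st mst.
have m0 : (0 : R) < k%:R by rewrite ltr0n; lia.
have p0 := pi_gt0 R.
set th := pi / k%:R.
have s0 : sin th != 0.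
  rewrite gt_eqF//; apply: sin_gt0_pi; rewrite divr_gt0//= ltr_pdivrMr//.
  by rewrite -[ltLHS]mulr1 ltr_pM2l// (ltr_nat R 1 k).
have th2 : th *+ k.*2 = pi *+ 2.
  by rewrite -mul2n mulnC mulrnA -[th *+ k]mulr_natr divfK// gt_eqF.
split.
- by rewrite sqrrN -sin2cos2 expf_neq0.
- apply: (mulfI s0); rewrite chebyshev_cos th2 mulr0 -[pi *+ 2]add0r.
  by rewrite sinD2pi sin0.
- apply: (mulfI s0); rewrite chebyshev_cos mulrSr th2 mulr1 addrC.
  by rewrite sinD2pi.
- apply: (mulfI s0); rewrite chebyshev_cos.
  have -> : th *+ k.*2.-1 = - th + pi *+ 2.
    rewrite -th2 -[in RHS](@prednK k.*2) ?mulrS ?addKr//.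
    by rewrite double_gt0; lia.
  by rewrite sinD2pi sinN mulrN1.
Qed.

(** For distinct s and t with m(s,t) finite, the form is nondegenerate on the plane of alpha_s and
    alpha_t, so every vector splits into a part in the plane, handled by the Chebyshev values, and
    an orthogonal part, fixed by both reflections. *)
Lemma refl_relation s t k v : cox_matrix C s t = Some k ->
  iter k (refl s \o refl t) v = v.
Proof.
have [<-|st] := eqVneq s t => mst.
  by move: mst; rewrite cox_entry_diag => -[<-] /=; exact: reflK.
have [d0 U0 U1 U1'] := chebyshev_period st mst.
have m2 := cox_entry_ge2 st mst.
have fixs : foldr refl (root0 s) (alt_word s t k.*2) = root0 s.
  by rewrite foldr_refl_alternating odd_double U0 U1 scale0r addr0 scale1r.
have fixt : foldr refl (root0 t) (alt_word s t k.*2) = root0 t.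
  (* The last letter only negates alpha_t, which leaves a word of odd length 2k - 1 to apply. *)
  have ek : k.*2 = k.*2.-1.+1 by rewrite prednK// double_gt0; lia.
  have ok : odd k.*2.-1 by move: (odd_double k); rewrite {1}ek /=; case: odd.
  rewrite ek /= foldr_rcons refl_self foldr_reflN foldr_refl_alternating -ek ok.
  by rewrite (cox_gram_sym t s) U0 U1' scale0r add0r scaleN1r opprK.
pose g := gram s t; pose p := form v (root0 s); pose q := form v (root0 t).
(* Coefficients of the orthogonal projection to the plane, by Cramer's rule. *)
pose a := (p - g * q) / (1 - g ^+ 2); pose b := (q - g * p) / (1 - g ^+ 2).
pose v0 := v - (a *: root0 s + b *: root0 t).
have v0s : form v0 (root0 s) = 0.
  rewrite /v0 cox_formB cox_form_linear cox_formZ !cox_form_simple.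
  by rewrite cox_gram_diag (cox_gram_sym t) /a /b -/g -/p; field.
have v0t : form v0 (root0 t) = 0.
  rewrite /v0 cox_formB cox_form_linear cox_formZ !cox_form_simple.
  by rewrite cox_gram_diag /a /b -/g -/q; field.
have -> : v = a *: root0 s + (b *: root0 t + v0).
  by rewrite /v0 addrA addrC subrK.
rewrite iter_refl !foldr_refl_linear fixs fixt -iter_refl.
by rewrite foldr_refl_fixed.
Qed.

(** The universal property extends the reflections to a homomorphism into the bijections of the root
    space, so the word chosen in [cox_act] does not matter. *)
Lemma cox_act_wp x v : act (wp x) v = foldr refl v x.
Proof.
pose F s := Bijection (reflK s) (reflK s).
have FX s t n w : bij_fun ((F s * F t) ^+ n)%g w = iter n (refl s \o refl t) w.
  by elim: n => // n IH; rewrite expgS /= -IH.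
have [h hE] : exists h : {multiplicative W -> bijection V}, forall s, h (sg s) = F s.
  apply: cox_universal => s t k mst; apply: bijectionP => w.
  by rewrite FX refl_relation.
have hwp y : h (wp y) = word_prod F y.
  elim: y => [|s y IH].
    by apply: (mulgI (h 1%g)); rewrite /word_prod !big_nil -gmulfM !mulg1.
  by rewrite wp_cons gmulfM hE IH /word_prod big_cons.
rewrite /cox_act; case: cid => y /= ey.
by rewrite -2!(bij_fun_prod F) -!hwp ey.
Qed.

Lemma cox_act1 v : act 1%g v = v.
Proof. by rewrite -(wp_nil C) cox_act_wp. Qed.

Lemma cox_actM x y v : act (x * y)%g v = act x (act y v).
Proof.
have [[x' <-] [y' <-]] := (cox_generated C x, cox_generated C y).
by rewrite -wp_cat !cox_act_wp foldr_cat.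
Qed.

Lemma cox_act_gen s v : act (sg s) v = refl s v.
Proof. by rewrite -[sg s]mulg1 -(wp_nil C) -wp_cons cox_act_wp. Qed.

Lemma cox_actK x v : act x^-1%g (act x v) = v.
Proof. by rewrite -cox_actM mulVg cox_act1. Qed.

Lemma cox_actKV x v : act x (act x^-1%g v) = v.
Proof. by rewrite -cox_actM mulgV cox_act1. Qed.

Lemma cox_act_linear x a u v : act x (a *: u + v) = a *: act x u + act x v.
Proof.
by have [x' <-] := cox_generated C x; rewrite !cox_act_wp foldr_refl_linear.
Qed.

Lemma cox_act0 x : act x 0 = 0.
Proof. by have [x' <-] := cox_generated C x; rewrite cox_act_wp foldr_refl0. Qed.

Lemma cox_actN x v : act x (- v) = - act x v.
Proof. by have [x' <-] := cox_generated C x; rewrite !cox_act_wp foldr_reflN. Qed.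

Lemma cox_actZ x a v : act x (a *: v) = a *: act x v.
Proof. by rewrite -[_ *: v]addr0 cox_act_linear cox_act0 addr0. Qed.

Lemma cox_form_act x u v : form (act x u) (act x v) = form u v.
Proof.
have [x' <-] := cox_generated C x; rewrite !cox_act_wp.
by elim: x' => //= s x' IH; rewrite cox_form_refl.
Qed.

End Geometry.

(** * Roots and inversion sets *)

Section RootSigns.
Variables (R : realType) (W : groupType) (S : finType).
Variable C : coxeter_system W S.
Local Open Scope ring_scope.
Local Open Scope classical_set_scope.

Local Notation V := {ffun S -> R^o}.
Local Notation root0 := (@simple_root R S).
Local Notation form := (@cox_form R W S C).
Local Notation sg := (cox_gen C).
Local Notation len := (cox_length C).
Local Notation wp := (word_prod (cox_gen C)).
Local Notation act := (@cox_act R W S C).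
Local Notation roots := (@cox_roots R W S C).
Local Notation pos := (@positive_roots R W S C).
Local Notation neg := (@negative_roots R W S C).
Local Notation inv := (@inversions R W S C).
Implicit Types (a b : V) (s t : S) (w x y : W).

(** Induction on length. With a descent t of w, write w = v u, where u is a word in s and t and v is
    minimal in its coset. Then u alpha_s is a combination of alpha_s and alpha_t with nonnegative
    Chebyshev coefficients, and the shorter v keeps both roots nonnegative. *)
Lemma cox_act_simple_ge0 w s : len (w * sg s)%g = (len w).+1 ->
  forall z, 0 <= act w (root0 s) z.
Proof.
elim/ltn_ind: {w}(len w) {-2}w s (erefl (len w)) => n IH w s lw ls z.
have [w1|/(descent_ex C)[t lt]] := pselect (w = 1%g).
  by rewrite w1 cox_act1 ffunE ler0n.
have st : s != t.
  by apply/eqP => est; move: lt; rewrite -est ls; lia.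
have [v [u [ew uall lu lvs lvt]]] := coset_decomposition C s t w.
have u0 : (0 < size u)%N.
  case: u ew {uall} lu => //; rewrite wp_nil mulg1 => ewv _.
  by move: lt; rewrite ewv lvt; lia.
have lev : (len v < n)%N by rewrite -lw lu; lia.
have lvu : len (v * wp u)%g = (len v + size u)%N by rewrite -ew.
(* A nonempty [u] ending in [s] is impossible, since w s would then be shorter than w. *)
case: (reduced_alternating uall lvu) => eu; last first.
  move: u0 lu ls; rewrite ew eu; case: (size u) => //= k _.
  rewrite wp_rcons mulgA size_rcons size_alternating => ->.
  rewrite mulg_genK => lk; have := cox_lengthM C v (wp (alt_word s t k)).
  by have := cox_length_wp C (alt_word s t k); rewrite lk size_alternating; lia.
(* The bound is strict because the coefficient of index size u + 1 must also be nonnegative. *)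
have chk : if cox_matrix C s t is Some m then (size u < m)%N else true.
  case mst : (cox_matrix C s t) => [m|//].
  apply: (alternating_lt mst _ _ lu ls); last by rewrite -eu.
  by have := cox_entry_ge2 st mst; lia.
rewrite ew cox_actM cox_act_wp eu foldr_refl_alternating cox_act_linear cox_actZ.
have v_ge0 (b : bool) : 0 <= act v (root0 (if b then t else s)) z.
  by case: b; apply: (IH _ lev).
rewrite !ffunE /= /GRing.scale /= addr_ge0// mulr_ge0//; last 1 first.
- by case: odd; [exact: (v_ge0 false) | exact: (v_ge0 true)].
- by apply: chebyshev_ge0 => //; case: (cox_matrix C s t) chk.
- by apply: chebyshev_ge0 => //; case: (cox_matrix C s t) chk => // m /ltnW.
Qed.

(** * Positive and negative roots *)

Lemma cox_root_act w a : roots a -> roots (act w a).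
Proof. by move=> [v [s ->]]; exists (w * v)%g, s; rewrite cox_actM. Qed.

Lemma cox_rootN a : roots a -> roots (- a).
Proof.
move=> [v [s ->]]; exists (v * sg s)%g, s.
by rewrite cox_actM cox_act_gen refl_self cox_actN.
Qed.

Lemma cox_root_norm a : roots a -> form a a = 1.
Proof.
by move=> [v [s ->]]; rewrite cox_form_act cox_form_simple cox_gram_diag.
Qed.

Lemma pos_rootN a : pos a -> neg (- a).
Proof.
by move=> [ra a0]; split; [exact: cox_rootN | move=> s; rewrite ffunE oppr_le0].
Qed.

Lemma neg_rootN a : neg a -> pos (- a).
Proof.
by move=> [ra a0]; split; [exact: cox_rootN | move=> s; rewrite ffunE oppr_ge0].
Qed.

Lemma pos_not_neg a : pos a -> neg a -> False.
Proof.
move=> [ra a0] [_ a0']; have := cox_root_norm ra.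
have -> : a = 0.
  by apply/ffunP => s; apply/eqP; rewrite ffunE eq_le a0 a0'.
by rewrite cox_form0 => /esym/eqP; rewrite oner_eq0.
Qed.

Lemma cox_act_simple_pos w s : len (w * sg s)%g = (len w).+1 ->
  pos (act w (root0 s)).
Proof. by move=> lw; split; [exists w, s | exact: cox_act_simple_ge0]. Qed.

Lemma cox_act_simple_neg w s : (len (w * sg s)%g).+1 = len w ->
  neg (act w (root0 s)).
Proof.
move=> lw; rewrite -[act _ _]opprK; apply: pos_rootN.
rewrite -cox_actN -(refl_self R C) -cox_act_gen -cox_actM.
by apply: cox_act_simple_pos; rewrite mulg_genK.
Qed.

Lemma simple_root_pos s : pos (root0 s).
Proof.
split; first by exists 1%g, s; rewrite cox_act1.
by move=> t; rewrite ffunE ler0n.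
Qed.

Lemma pos_or_neg a : roots a -> pos a \/ neg a.
Proof.
move=> [w [s ->]]; case: (cox_length_gen C w s) => lw.
  by left; exact: cox_act_simple_pos.
by right; exact: cox_act_simple_neg.
Qed.

Lemma pos_act_simple w s : pos (act w (root0 s)) -> len (w * sg s)%g = (len w).+1.
Proof.
move=> wpos; case: (cox_length_gen C w s) => // /cox_act_simple_neg.
by move=> /(pos_not_neg wpos).
Qed.

Lemma pos_coord a s : roots a -> 0 < a s -> pos a.
Proof. by move=> /pos_or_neg[//|[_ /(_ s)]]; rewrite leNgt => /negP. Qed.

Lemma neg_coord a s : roots a -> a s < 0 -> neg a.
Proof. by move=> /pos_or_neg[[_ /(_ s)]|//]; rewrite leNgt => /negP. Qed.

(** The reflection changes the s-coordinate only, so any other positive coordinate survives. Without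
    one, [a] is a multiple of alpha_s, and its norm 1 and its sign force it to be alpha_s. *)
Lemma pos_refl a s : pos a -> a <> root0 s -> pos (act (sg s) a).
Proof.
move=> [ra a0] as_; have [|nt] := pselect (exists2 t, t != s & a t != 0).
  move=> [t ts at0]; apply: (@pos_coord _ t); first exact: cox_root_act.
  by rewrite cox_act_gen reflE (negbTE ts) mulr0 subr0 lt0r at0 a0.
case: as_; have ea : a = a s *: root0 s.
  apply/ffunP => t; rewrite !ffunE /= /GRing.scale /=.
  have [->|ts] := eqVneq t s; first by rewrite mulr1.
  by rewrite mulr0; apply/eqP/negPn/negP => at0; apply: nt; exists t.
have := cox_root_norm ra.
rewrite {1 2}ea cox_formZ cox_form_sym cox_formZ cox_form_simple cox_gram_diag.
rewrite mulr1 -expr2 => /eqP; rewrite sqrf_eq1 => /orP[]/eqP e1.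
  by rewrite ea e1 scale1r.
by have := a0 s; rewrite e1 lerNr oppr0 leNgt ltr01.
Qed.

Lemma inversion_or_pos w a : pos a -> inv w a \/ pos (act w^-1%g a).
Proof.
by move=> pa; case: (pos_or_neg (cox_root_act w^-1%g pa.1)); [right|left].
Qed.

(** The generator s keeps every positive root other than alpha_s positive, so only the sign at w
    alpha_s changes. *)
Lemma inversions_step w s : len (w * sg s)%g = (len w).+1 ->
  inv (w * sg s)%g = inv w `|` [set act w (root0 s)].
Proof.
move=> lw; apply/seteqP; split=> a /=.
- move=> [pa]; rewrite invgM cox_genV cox_actM => na.
  case: (inversion_or_pos w pa) => [|p]; first by left.
  right; have [<-|ne] := pselect (act w^-1%g a = root0 s).
    by rewrite cox_actKV.
  by case: (pos_not_neg (pos_refl p ne) na).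
- rewrite /inversions /= invgM cox_genV cox_actM.
  case=> [[pa na]|->]; last first.
    split; first exact: cox_act_simple_pos.
    rewrite cox_actK cox_act_gen refl_self; apply: pos_rootN.
    exact: simple_root_pos.
  split=> //; rewrite -[X in neg X]opprK -cox_actN; apply/pos_rootN.
  apply: pos_refl; first exact: neg_rootN.
  move=> eN; apply: (pos_not_neg pa).
  rewrite -[a](cox_actKV C w) -[act w^-1%g a]opprK eN cox_actN.
  exact/pos_rootN/cox_act_simple_pos.
Qed.

(** * Weak order and inversion sets *)

Lemma weak_le_inversions x y : right_weak_le C x y -> inv x `<=` inv y.
Proof.
rewrite /right_weak_le; have [u [eu <-]] := reduced_ex C (x^-1 * y)%g.
have -> : y = (x * wp u)%g by rewrite eu mulVKg.
elim/last_ind: u {eu} => [|u s IH] lu; first by rewrite wp_nil mulg1.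
rewrite size_rcons in lu.
have lu' : len (x * wp u)%g = (len x + size u)%N.
  have := @cox_length_prefix _ _ C x (rcons u s) (size u).
  by rewrite size_rcons -[in take _ _]cats1 take_size_cat //; exact.
rewrite wp_rcons mulgA inversions_step; first by move=> a /(IH lu'); left.
by move: lu; rewrite wp_rcons mulgA => ->; rewrite lu' addnS.
Qed.

(** If lengths add, x^-1 lies below x^-1 y, and a common inversion a would make -x^-1 a an inversion
    of the first but not of the second. The converse builds y up one descent at a time. *)
Lemma length_disjoint x y : len (x^-1 * y)%g = (len x + len y)%N <->
  inv x `&` inv y = set0.
Proof.
split=> [lxy|].
  have : right_weak_le C x^-1%g (x^-1 * y)%g.
    by rewrite /right_weak_le mulKg lxy cox_lengthV.
  move=> /weak_le_inversions sub; rewrite -subset0 => a [[pa na] [_ na']].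
  have [_] : inv (x^-1 * y)%g (- act x^-1%g a).
    apply: sub; split; first exact: neg_rootN.
    by rewrite cox_actN invgK cox_actKV; exact: pos_rootN.
  rewrite invgM cox_actM cox_actN invgK cox_actN cox_actKV => /neg_rootN.
  by rewrite opprK => /pos_not_neg; apply.
move ly : (len y) => n; elim/ltn_ind: n y ly => n IH y ly dis.
have [y1|/(descent_ex C)[s ls]] := pselect (y = 1%g).
  by rewrite -ly y1 cox_length1 addn0 mulg1 cox_lengthV.
have ys : y = (y * sg s * sg s)%g by rewrite mulg_genK.
have l1 : len (y * sg s * sg s)%g = (len (y * sg s)%g).+1 by rewrite -ys.
have step := inversions_step l1; rewrite mulg_genK in step.
have ltn : (len (y * sg s)%g < n)%N by rewrite -ly -ls.
have := IH _ ltn (y * sg s)%g erefl.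
rewrite -ly -ls addnS => <-; last first.
  by rewrite -subset0 -dis step; exact: setIS.
(* The root added by the last letter s is an inversion of y, hence not of x; x^-1 keeps it positive,
   so this letter lengthens. *)
rewrite -{1}[y](mulg_genK C s) mulgA; apply: pos_act_simple.
rewrite cox_actM; case: (inversion_or_pos x (cox_act_simple_pos l1)) => // xin.
suff : set0 (act (y * sg s)%g (root0 s)) by [].
by rewrite -dis; split=> //; rewrite step; right.
Qed.

(** By [length_disjoint] it suffices that x^-1 and x^-1 y have no common inversion a: otherwise -x a
    would be an inversion of x, hence of y, although y^-1 x a is negative. *)
Lemma inversions_weak_le x y : inv x `<=` inv y -> right_weak_le C x y.
Proof.
move=> sub; rewrite /right_weak_le -{1}(mulVKg x y) -{1}[x]invgK.
have := length_disjoint x^-1%g (x^-1 * y)%g; rewrite cox_lengthV.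
rewrite invgK => -[_]; apply.
rewrite -subset0 => a [[pa]]; rewrite invgK => na [_].
rewrite invgM invgK cox_actM => na'.
have [_ na''] : inv y (- act x a).
  by apply: sub; split; [exact: neg_rootN | rewrite cox_actN cox_actK; exact: pos_rootN].
apply: (pos_not_neg _ na''); rewrite cox_actN; exact: neg_rootN.
Qed.

Lemma weak_leE x y : right_weak_le C x y <-> inv x `<=` inv y.
Proof. by split; [exact: weak_le_inversions | exact: inversions_weak_le]. Qed.

Lemma weak_le_length_eq x y : right_weak_le C x y -> (len y <= len x)%N -> x = y.
Proof.
rewrite /right_weak_le => -> le0; have : len (x^-1 * y)%g = 0%N by lia.
by move=> /cox_length_eq0/mulg1_eq; rewrite invgK.
Qed.

Lemma inversions_inj x y : inv x = inv y -> x = y.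
Proof.
move=> exy; have /weak_leE xy : inv x `<=` inv y by rewrite exy.
have /weak_leE : inv y `<=` inv x by rewrite exy.
by move: (xy) => /weak_le_length_eq + lyx; apply; rewrite lyx leq_addr.
Qed.

End RootSigns.

(** * Cone boundaries *)

Section Boundary.
Variables (R : realType) (W : groupType) (S : finType).
Variable C : coxeter_system W S.
Local Open Scope ring_scope.
Local Open Scope classical_set_scope.

Local Notation V := {ffun S -> R^o}.
Local Notation root0 := (@simple_root R S).
Local Notation refl := (@simple_reflection R W S C).
Local Notation sg := (cox_gen C).
Local Notation len := (cox_length C).
Local Notation wp := (word_prod (cox_gen C)).
Local Notation act := (@cox_act R W S C).
Local Notation roots := (@cox_roots R W S C).
Local Notation pos := (@positive_roots R W S C).
Local Notation neg := (@negative_roots R W S C).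
Local Notation inv := (@inversions R W S C).
Local Notation bdry := (@cone_boundary R W S C).
Implicit Types (a b : V) (s t : S) (w x y z : W).

(** * Inversions along rank-two cosets and reduced paths *)

Lemma foldr_refl_outside s t u a (z : S) : all [in [:: s; t]] u -> z \notin [:: s; t] ->
  foldr refl a u z = a z.
Proof.
move=> + zst; elim: u => //= r u IH /andP[rst uall].
rewrite reflE IH//; case: eqVneq => [zr|_]; last by rewrite mulr0 subr0.
by move: zst; rewrite zr rst.
Qed.

Lemma pos_support s t a : pos a ->
  (exists2 z : S, z \notin [:: s; t] & 0 < a z) \/
  (exists c d, [/\ 0 <= c, 0 <= d & a = c *: root0 s + d *: root0 t]).
Proof.
move=> [_ a0]; have [|nz] := pselect (exists2 z : S, z \notin [:: s; t] & 0 < a z).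
  by left.
(* When s = t the second coefficient is 0, so that the coordinate is not counted twice. *)
right; exists (a s), (if s == t then 0 else a t); split=> //.
  by case: eqP.
apply/ffunP => z; rewrite !ffunE /= /GRing.scale /=.
have [zs|zs] := eqVneq z s.
  by subst z; case: eqVneq => _; rewrite mulr1 ?mul0r ?mulr0 addr0.
have [zt|zt] := eqVneq z t.
  by subst z; rewrite eq_sym (negbTE zs) mulr0 mulr1 add0r.
rewrite !mulr0 addr0; apply/eqP; rewrite eq_le a0 andbT leNgt; apply/negP => az.
by apply: nz; exists z; rewrite // !inE negb_or zs zt.
Qed.

(** For an inversion a of v, the root -v^-1 a is positive. A coordinate of it outside s and t is
    untouched by u, so a stays inverted. Otherwise it is a nonnegative combination of alpha_s and
    alpha_t, and v would make -a nonnegative. *)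
Lemma coset_inversions s t v u : all [in [:: s; t]] u ->
  len (v * sg s)%g = (len v).+1 -> len (v * sg t)%g = (len v).+1 ->
  inv v `<=` inv (v * wp u)%g.
Proof.
move=> uall ls lt a [pa na]; split=> //.
rewrite invgM cox_actM -wp_rev cox_act_wp.
have ra : roots (foldr refl (act v^-1%g a) (rev u)).
  by rewrite -cox_act_wp; do 2 apply: cox_root_act; exact: pa.1.
have [[z zst az]|[c [d [c0 d0 e]]]] := pos_support s t (neg_rootN na).
  apply: (@neg_coord _ _ _ _ _ z) => //.
  rewrite (foldr_refl_outside _ _ zst) ?all_rev//.
  by move: az; rewrite ffunE oppr_gt0.
case: (pos_not_neg pa); split; first exact: pa.1.
move=> z; rewrite -[a](cox_actKV C v) -[act v^-1%g a]opprK cox_actN e.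
rewrite cox_act_linear cox_actZ !ffunE oppr_le0 /GRing.scale /=.
by rewrite addr_ge0// mulr_ge0// cox_act_simple_ge0.
Qed.

Lemma inversions_descent y s : (len (y * sg s)%g).+1 = len y ->
  inv y = inv (y * sg s)%g `|` [set - act y (root0 s)].
Proof.
move=> ly; have := @inversions_step R _ _ C (y * sg s)%g s.
rewrite mulg_genK cox_actM cox_act_gen refl_self cox_actN; apply.
by rewrite ly.
Qed.

Lemma inversion_descent_self y s : (len (y * sg s)%g).+1 = len y ->
  inv y (- act y (root0 s)).
Proof. by move=> ly; rewrite (inversions_descent ly); right. Qed.

Lemma inversion_descent_neq y s : ~ inv (y * sg s)%g (- act y (root0 s)).
Proof.
move=> [_]; rewrite invgM cox_genV cox_actM cox_actN cox_actK cox_actN.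
rewrite cox_act_gen refl_self opprK => /pos_not_neg; apply.
exact: simple_root_pos.
Qed.

(** Both sides of the wall of a root are convex: a reduced path crosses each wall at most once,
    because the inversions of a prefix of a reduced word are inversions of the whole. *)
Lemma inversions_between y z u j a : reduced_expression C (y^-1 * z)%g u ->
  let k := (y * wp (take j u))%g in
  (inv y a -> inv z a -> inv k a) /\ (inv k a -> inv y a \/ inv z a).
Proof.
move=> [eu su] k; pose p := wp (take j u).
have sub : inv p `<=` inv (y^-1 * z)%g.
  apply: weak_le_inversions; rewrite /right_weak_le.
  have -> : (p^-1 * (y^-1 * z))%g = wp (drop j u).
    by rewrite -eu -[u in LHS](cat_take_drop j) wp_cat mulKg.
  have := cox_lengthM C p (wp (drop j u)).
  have := cox_length_wp C (take j u); have := cox_length_wp C (drop j u).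
  rewrite /p -wp_cat cat_take_drop eu -su.
  by have := size_cat (take j u) (drop j u); rewrite cat_take_drop; lia.
have kE : act k^-1%g a = act p^-1%g (act y^-1%g a) by rewrite invgM cox_actM.
have zE : act z^-1%g a = act (y^-1 * z)^-1%g (act y^-1%g a).
  by rewrite -cox_actM invgM invgK mulgK.
split.
  move=> [pa na] [_ nz]; case: (inversion_or_pos k pa) => //; rewrite kE => pk.
  have [_] : inv (y^-1 * z)%g (- act y^-1%g a).
    apply: sub; split; first exact: neg_rootN.
    by rewrite cox_actN; exact: pos_rootN.
  rewrite cox_actN -zE => /neg_rootN; rewrite opprK => pz.
  by case: (pos_not_neg pz nz).
move=> [pa nk]; case: (inversion_or_pos y pa) => [|py]; first by left.
right; split=> //; rewrite zE; apply: (sub _ _).2; split=> //.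
by rewrite -kE.
Qed.

(** * The boundary at a fixed root *)

Section FixedRoot.
Variables (x : W) (b : V).
Hypothesis xb : inv x b.

Lemma boundaryP y :
  bdry x b y <-> inv y b /\ forall a, inv x a -> inv y a -> a = b.
Proof.
split=> [e|[yb uniq_b]].
  split=> [|a xa ya]; first by have [] : (inv x `&` inv y) b by rewrite e.
  by have : (inv x `&` inv y) a by []; rewrite e.
by apply/seteqP; split=> [a [xa ya]|a ->]; [exact: uniq_b | split].
Qed.

Lemma boundary_between m k y : bdry x b m -> bdry x b y ->
  inv m `<=` inv k -> inv k `<=` inv y -> bdry x b k.
Proof.
move=> /boundaryP[mb _] /boundaryP[_ yu] mk ky; apply/boundaryP; split.
  exact: mk.
by move=> a xa /ky; exact: yu.
Qed.

Lemma boundary_convex : convex_subset C (bdry x b).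
Proof.
move=> y z /boundaryP[yb yu] /boundaryP[zb zu] u ru j _; apply/boundaryP.
split; first by have [+ _] := inversions_between j b ru; exact.
move=> a xa ka; have [_ /(_ ka)[ya|za]] := inversions_between j a ru.
  exact: yu.
exact: zu.
Qed.

(* If [b] is not inverted by the minimal representative [y0] of the coset of [y],
   it is a positive combination of the roots [- y alpha_s] and [- y alpha_t];
   as [x^-1] makes [b] negative, it makes one of them negative. *)
Lemma boundary_diamond y s t :
  bdry x b y -> (len (y * sg s)%g).+1 = len y -> (len (y * sg t)%g).+1 = len y ->
  bdry x b (y * sg s)%g -> bdry x b (y * sg t)%g ->
  exists y0, [/\ bdry x b y0, inv y0 `<=` inv (y * sg s)%g &
    inv y0 `<=` inv (y * sg t)%g].
Proof.
move=> /boundaryP[yb yu] ls lt /boundaryP[ysb _] /boundaryP[ytb _].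
have [y0 [u [ey uall _ ls0 lt0]]] := coset_decomposition C s t y.
have sub r : r \in [:: s; t] -> inv y0 `<=` inv (y * sg r)%g.
  move=> rst; rewrite ey -mulgA -wp_rcons; apply: coset_inversions ls0 lt0.
  by rewrite all_rcons rst.
exists y0; split; [|by apply: sub; rewrite !inE eqxx ?orbT ..].
have suby : inv y0 `<=` inv y by rewrite ey; exact: coset_inversions ls0 lt0.
apply/boundaryP; split; last by move=> a xa /suby; exact: yu.
split; first exact: xb.1.
have no_descent r : (len (y * sg r)%g).+1 = len y -> inv (y * sg r)%g b ->
    pos (act x^-1%g (- act y (root0 r))).
  move=> lr yrb; have yr := inversion_descent_self lr.
  case: (inversion_or_pos x yr.1) => // xr.
  by have := yu _ xr yr => rb; move: yrb; rewrite -rb => /inversion_descent_neq.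
have [[z zst dz]|[c [d [c0 d0 e]]]] := pos_support s t (neg_rootN yb.2).
  apply: (@neg_coord _ _ _ _ _ z); first exact: cox_root_act xb.1.1.
  have -> : act y0^-1%g b = act (wp u) (act y^-1%g b).
    by rewrite -cox_actM ey invgM mulVKg.
  rewrite cox_act_wp (foldr_refl_outside _ uall zst).
  by move: dz; rewrite ffunE oppr_gt0.
case: (pos_not_neg _ xb.2); split; first exact: cox_root_act xb.1.1.
move=> z; rewrite -[b](cox_actKV C y) -[act y^-1%g b]opprK e.
rewrite cox_actN cox_act_linear cox_actZ opprD -!scalerN cox_act_linear cox_actZ.
rewrite !ffunE /GRing.scale /= addr_ge0// mulr_ge0//.
  exact: (no_descent s ls ysb).2.
exact: (no_descent t lt ytb).2.
Qed.

(** * Minimal elements and the gate of the boundary *)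

Definition boundary_minimal m := bdry x b m /\
  forall k, bdry x b k -> inv k `<=` inv m -> k = m.

Lemma boundary_minimal_ex y : bdry x b y ->
  exists2 m, boundary_minimal m & inv m `<=` inv y.
Proof.
move ly : (len y) => n; elim/ltn_ind: n y ly => n IH y ly Xy.
have [my|] := pselect (boundary_minimal y); first by exists y.
move=> nmin; have [k [Xk ky kney]] : exists k, [/\ bdry x b k, inv k `<=` inv y & k <> y].
  apply: contrapT => nk; apply: nmin; split=> // k Xk ky.
  by apply: contrapT => kney; apply: nk; exists k.
have kl : (len k < n)%N.
  rewrite -ly ltnNge; apply/negP; apply: contra_not kney.
  exact/weak_le_length_eq/inversions_weak_le/ky.
by have [m mm mk] := IH _ kl k erefl Xk; exists m => // a /mk/ky.
Qed.

(** A descent of m^-1 y serves: removing it from y stays above m. *)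
Lemma inversions_sub_descent m y : inv m `<=` inv y -> m <> y ->
  exists2 s, (len (y * sg s)%g).+1 = len y & inv m `<=` inv (y * sg s)%g.
Proof.
move=> /inversions_weak_le; rewrite /right_weak_le => ly my.
have my1 : (m^-1 * y)%g <> 1%g by move=> /mulg1_eq; rewrite invgK.
have [s ls] := descent_ex C my1.
have := cox_lengthM C m (m^-1 * (y * sg s))%g.
rewrite mulVKg mulgA => lys; rewrite -ls addnS in ly.
have lys' : (len (y * sg s)%g).+1 = len y.
  case: (cox_length_gen C y s) => // l1.
  by move: lys; rewrite l1 ly => /ltnW; rewrite ltnn.
exists s => //; apply: weak_le_inversions; rewrite /right_weak_le mulgA.
by move: ly; rewrite -lys' => -[].
Qed.

(* Newman's lemma for the steps from [y] to [y s] that stay in the boundary. *)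
Lemma boundary_minimal_uniq y m m' : bdry x b y ->
  boundary_minimal m -> boundary_minimal m' ->
  inv m `<=` inv y -> inv m' `<=` inv y -> m = m'.
Proof.
move ly : (len y) => n; elim/ltn_ind: n y m m' ly => n IH y m m' ly Xy mm mm' my m'y.
have [e|/(inversions_sub_descent my)[s ls ms]] := pselect (m = y).
  by apply/esym/mm.2; [exact: mm'.1 | rewrite e].
have [e|/(inversions_sub_descent m'y)[t lt m't]] := pselect (m' = y).
  by apply/mm'.2; [exact: mm.1 | rewrite e].
have down r : (len (y * sg r)%g).+1 = len y -> inv (y * sg r)%g `<=` inv y.
  by move=> lr; rewrite (inversions_descent lr); left.
have Xs := boundary_between mm.1 Xy ms (down s ls).
have Xt := boundary_between mm'.1 Xy m't (down t lt).
have [y0 [X0 ys0 yt0]] := boundary_diamond Xy ls lt Xs Xt.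
have [m0 mm0 m0y] := boundary_minimal_ex X0.
transitivity m0.
  by apply: (IH _ _ (y * sg s)%g m m0 erefl) => //; [lia | exact: subset_trans ys0].
by apply: (IH _ _ (y * sg t)%g m0 m' erefl) => //; [lia | exact: subset_trans yt0].
Qed.

(** A minimal g below y stays below every element of a reduced path from y to z, which remains in
    the boundary by convexity. An ascent enlarges the inversion set; after a descent, any minimal
    element below the new point is also below the old one and so equals g. *)
Lemma boundary_gate y : bdry x b y ->
  exists2 g, bdry x b g & forall z, bdry x b z -> inv g `<=` inv z.
Proof.
move=> Xy; have [g mg gy] := boundary_minimal_ex Xy; exists g; first exact: mg.1.
move=> z Xz; have [u ru] := reduced_ex C (y^-1 * z)%g.
have := boundary_convex Xy Xz ru; rewrite -[z](mulVKg y) -ru.1.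
elim: u y Xy gy {ru Xz} => [|r u IH] y Xy gy path; first by rewrite wp_nil mulg1.
have Xr : bdry x b (y * sg r)%g.
  by have := path 1%N isT; rewrite /= take0 wp_cons wp_nil mulg1.
rewrite wp_cons mulgA; apply: IH => //; last first.
  by move=> j ju; have := path j.+1 ju; rewrite /= wp_cons mulgA.
case: (cox_length_gen C y r) => lr.
  by rewrite (inversions_step R lr) => a /gy; left.
have [m mm mr] := boundary_minimal_ex Xr.
rewrite (boundary_minimal_uniq Xy mg mm gy)//.
by move=> a /mr; rewrite (inversions_descent lr); left.
Qed.

(** If the descent removed a root other than b, then g s would still lie in the boundary, strictly
    below g. *)
Lemma gate_descent g s : bdry x b g ->
  (forall z, bdry x b z -> inv g `<=` inv z) ->
  (len (g * sg s)%g).+1 = len g -> - act g (root0 s) = b.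
Proof.
move=> /boundaryP[gb gu] ming lg; apply: contrapT => ne.
have : bdry x b (g * sg s)%g.
  apply/boundaryP; move: gb gu; rewrite (inversions_descent lg) => gb gu; split.
    by case: gb => // /esym.
  by move=> a xa ga; apply: gu => //; left.
move=> /ming sub; apply: (@inversion_descent_neq g s).
exact/sub/inversion_descent_self.
Qed.

Lemma gate_descent_ex g : bdry x b g ->
  exists s, (len (g * sg s)%g).+1 = len g.
Proof.
move=> /boundaryP[[pb nb] _]; apply: (descent_ex C) => g1.
by move: nb; rewrite g1 invg1 cox_act1; exact: pos_not_neg.
Qed.

Lemma gate_right_descent_roots g : bdry x b g ->
  (forall z, bdry x b z -> inv g `<=` inv z) ->
  @right_descent_roots R W S C g = [set b].
Proof.
move=> Xg ming; have [s ls] := gate_descent_ex Xg.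
apply/seteqP; split=> [a [t lt <-]|a ->]; first exact: gate_descent lt.
by exists s => //; exact: gate_descent ls.
Qed.

End FixedRoot.

(** * From the boundary to cone types *)

Lemma boundary_sym x b y : bdry x b y -> bdry y b x.
Proof. by rewrite /cone_boundary /= setIC. Qed.

Lemma boundary_inversion x b y : bdry x b y -> inv x b.
Proof. by move=> e; have [] : (inv x `&` inv y) b by rewrite e. Qed.

Lemma cone_typeV x y : cone_type C x^-1%g y <-> inv x `&` inv y = set0.
Proof. by rewrite -(length_disjoint R) /cone_type /= cox_lengthV. Qed.

(* The gate [h] of the boundary of [g] in turn has the form [w s] with [w] in the
   cone of [g^-1] and [h] not in it, so [h] detects [b] for every [z] with the
   same cone type. *)
Lemma boundary_is_gate x b g : bdry x b g ->
  (forall z, bdry x b z -> inv g `<=` inv z) ->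
  is_gate C (cone_type C g^-1%g) g.
Proof.
move=> Xg ming; split=> // z Tz.
have gb := boundary_inversion (boundary_sym Xg).
have [h Xh minh] := boundary_gate gb (boundary_sym Xg).
have [s ls] := gate_descent_ex gb Xh.
have hb := gate_descent gb Xh minh ls.
have inh := inversions_descent ls; rewrite hb in inh.
have nb : ~ inv (h * sg s)%g b by rewrite -hb; exact: inversion_descent_neq.
have [_ hu] := (boundaryP gb h).1 Xh.
have : cone_type C g^-1%g (h * sg s)%g.
  apply/cone_typeV; rewrite -subset0 => a [ga wa]; apply: nb.
  by rewrite -(hu a) // inh; left.
rewrite -Tz => /cone_typeV zw.
have zb : inv z b.
  apply: contrapT => nzb.
  have : cone_type C z^-1%g h.
    apply/cone_typeV; rewrite inh setIUr zw set0U -subset0 => a [za ab].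
    by apply: nzb; rewrite -ab.
  by rewrite Tz => /cone_typeV; rewrite Xh => /seteqP[/(_ b)] /(_ erefl).
have Xz : bdry h b z.
  by apply: boundary_sym; rewrite /cone_boundary /= inh setIUr zw set0U setIidr// => a ->.
have hb' := boundary_inversion Xz.
(* The gate g' of the boundary of h is below both g and z. Being below g and inverting b, it lies in
   the boundary of x, so g is below g' and therefore below z. *)
have [g' Xg' ming'] := boundary_gate hb' Xz.
have g'g := ming' _ (boundary_sym Xh).
have xb := boundary_inversion Xg.
have : bdry x b g'.
  apply/boundaryP => //; split; first exact: boundary_inversion (boundary_sym Xg').
  by move=> a xa /g'g ga; exact: ((boundaryP xb g).1 Xg).2.
move=> /ming gg'; apply: inversions_weak_le => a /gg'; exact: ming'.
Qed.

End Boundary.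

Theorem theorem3p1 (R : realType) (W : groupType) (S : finType)
    (C : coxeter_system W S) (x : W) (beta : {ffun S -> R^o})
    (beta_inv : inversions C x beta)
    (boundary_ex : exists y : W, cone_boundary C x beta y) :
  (exists y_beta : W,
     unique (fun y : W => cone_boundary C x beta y /\
               forall z : W, cone_boundary C x beta z ->
                 (cox_length C y <= cox_length C z)%N) y_beta
     /\ tight_gates R C y_beta)
  /\ convex_subset C (cone_boundary C x beta)
  /\ gated C (cone_boundary C x beta).
Proof.
have [y Xy] := boundary_ex; have [g Xg ming] := boundary_gate beta_inv Xy.
have gle z : cone_boundary C x beta z -> right_weak_le C g z.
  by move=> /ming; exact: inversions_weak_le.
(* Uniqueness in [gated]: two least elements have equal inversion sets, and these determine the
   element. *)
split; last split; last by exists g; split=> // z [Xz /(_ g Xg) zg];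
  apply: (@inversions_inj R _ _ C); apply/seteqP; split;
  [exact: ming | exact: weak_le_inversions].
  exists g; split; last split.
  - split; first by split=> // z /gle ->; rewrite leq_addr.
    by move=> z [Xz /(_ g Xg)]; apply: weak_le_length_eq; exact: gle.
  - exists (cone_type C g^-1%g); first by exists g^-1%g.
    exact: boundary_is_gate Xg ming.
  - by rewrite (gate_right_descent_roots beta_inv Xg ming) card_set1.
exact: boundary_convex.
Qed.
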